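(* Let $G$ be the graph of an instance of 3DSM that contains as a subgraph (with the same ranks of edges) the 9-vertex graph $H$ described in the context. Suppose that $G$ contains five pairwise disjoint subgraphs $H_0,H_1,H_2,H_4,H_7$ that are copies of the gadget $K_1$ described in the context, in which the role of the vertex $x$ is played by the vertices $0,1,2,4,7$ of $H$, respectively, and that these subgraphs have no other common vertices with $H$. Suppose moreover that $G$ contains two disjoint subgraphs $H_{3,6}$ and $H_{5,8}$ that are copies of the gadget $K_2$ described in the context, in which the role of $x$ is played by the vertices $3$ and $5$, and the role of $z$ by the vertices $6$ and $8$, respectively, and that these subgraphs have no other common vertices with $H$. All seven subgraphs are pairwise disjoint. In each of these copies the parameters $r'_y$ (for $y$ the vertex of $H$ playing the role of $x$ or of $z$) equal $\rho_H(y)+1$. Suppose that $G$ has no other vertices, i.e. $V(G)=V(H_{3,6})\cup V(H_{5,8})\cup\bigcup_{v\in\{0,1,2,4,7\}}V(H_v)$, and that the ranks of all edges of $G$ not mentioned above are arbitrary. Then the instance of 3DSM defined by $G$ has no stable matching.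
   Context: **3DSMI and 3DSM.** An instance of 3DSMI of size $n$ is a directed graph $G$ without multiple edges whose vertex set $V(G)$ is partitioned into three sets (''genders'') $M,F,D$ with $|M|=|F|=|D|=n$, such that every edge goes from $M$ to $F$, from $F$ to $D$, or from $D$ to $M$. In the cyclic order $M\to F\to D\to M$ each gender has a ''next'' gender. Each edge $(v,v')$ carries a positive integer rank $r(v,v')$; for each vertex $v$ of outdegree $k$ the ranks of the edges going out of $v$ are exactly $1,\dots,k$, each used once. An instance of 3DSM of size $n$ is an instance of 3DSMI in which every vertex is joined by an edge to all $n$ vertices of the next gender. **Matchings.** A family is a directed cycle of length 3 in $G$ (cyclic shifts are identified). A matching $\mu$ is a set of pairwise vertex-disjoint families. For a vertex $v$ belonging to a family of $\mu$, $\mu(v)$ denotes the vertex following $v$ in that family and $R_\mu(v)=r(v,\mu(v))$; otherwise $\mu(v)=v$ and $R_\mu(v)=+\infty$. A triple $(v,v',v'')$ forming a directed 3-cycle in $G$ is blocking for $\mu$ if $r(v,v')<R_\mu(v)$, $r(v',v'')<R_\mu(v')$ and $r(v'',v)<R_\mu(v'')$. The matching $\mu$ is stable if it has no blocking triple. **The graph $H$.** Vertices $0,1,\dots,8$; the gender of $v$ is determined by $v \bmod 3$, the cyclic order of genders being residue $0\to1\to2\to0$. Edges and ranks: rank 1: $(0,1),(1,2),(2,3),(3,4),(4,5),(5,0),(6,4),(7,8),(8,0)$; rank 2: $(4,8),(8,6),(0,7),(1,5),(5,3),(3,1)$; rank 3: $(4,2)$. For $v\in V(H)$, $\rho_H(v)=\max_{(v,v')\in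 E(H)} r(v,v')$. **Gadget $K_1$** (parameter $r'_x$). Vertices $x,a,b,c,d,e,s,t$; the vertices $e,s$ have the same gender as $x$; $c,d$ have the next gender after that of $x$; $a,b,t$ have the next gender after that of $c,d$. Edges and ranks: rank 1: $(e,c),(c,a),(d,a),(a,x),(b,x),(t,e),(s,d)$; rank 2: $(t,s),(e,d),(c,b),(d,b),(a,e),(b,e)$; rank 3: $(b,s),(d,t)$; $r(x,c)=r'_x$, $r(x,d)=r'_x+1$. **Gadget $K_2$** (parameters $r'_x,r'_z$). Vertices $x,z,a,b,c,d,e,f,s,t$; the vertices $z,e,s$ have the same gender as $x$; $c,d$ have the next gender after that of $x$; $a,b,f,t$ have the next gender after that of $c,d$. Edges and ranks: rank 1: $(e,c),(c,a),(d,a),(a,x),(b,x),(t,e),(s,d),(f,e)$; rank 2: $(t,s),(e,d),(c,b),(d,b),(a,z),(b,z)$; rank 3: $(a,e),(b,e),(d,t),(c,f)$; rank 4: $(b,s)$; $r(x,c)=r'_x$, $r(x,d)=r'_x+1$, $r(z,c)=r'_z$, $r(z,d)=r'_z+1$. In each copy all vertices other than those playing the roles of $x$ (and $z$) lie outside $V(H)$. Thus $G$ has $60$ vertices, $20$ of each gender, i.e. the size of this 3DSM is $20$. *)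

(* Defs.v *)
From HB Require Import structures.
From mathcomp Require Import all_boot all_order all_algebra.

Set Implicit Arguments.
Unset Strict Implicit.
Unset Printing Implicit Defensive.

(* A directed graph without multiple edges, with genders and ranked edges.
   Genders are 0 = M, 1 = F, 2 = D in 'Z_3, so that the next gender is obtained
   by adding 1. The value of [rank] is meaningful on edges only. *)
Record ranked_graph (V : Type) := RankedGraph {
  gender : V -> 'Z_3;
  edge : rel V;
  rank : V -> V -> nat
}.

Definition is_3DSMI (n : nat) (V : finType) (G : ranked_graph V) : Prop :=
  [/\ forall g : 'Z_3, #|[set v | gender G v == g]| = n,
      forall v w, edge G v w -> gender G w = (gender G v + 1)%R
    & forall v, perm_eq [seq rank G v w | w in [set w | edge G v w]]
                        (iota 1 #|[set w | edge G v w]|)].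

Definition is_3DSM (n : nat) (V : finType) (G : ranked_graph V) : Prop :=
  is_3DSMI n G /\
  forall v w, gender G w = (gender G v + 1)%R -> edge G v w.

Section Matchings.
Variables (V : finType) (G : ranked_graph V).

(* Along a directed 3-cycle the genders are cyclically shifted, so that exactly
   one of its cyclic shifts starts in M: that shift represents the family. *)
Definition is_family (t : 3.-tuple V) : bool :=
  ucycleb (edge G) t && (gender G (thead t) == 0%R).

Definition is_matching (mu : {set 3.-tuple V}) : Prop :=
  (forall t, t \in mu -> is_family t) /\
  (forall t u, t \in mu -> u \in mu -> t != u -> [disjoint t & u]).

Definition matched (mu : {set 3.-tuple V}) (v : V) : bool :=
  [exists t in mu, v \in t].

Definition partner (mu : {set 3.-tuple V}) (v : V) : V :=
  if [pick t in mu | v \in t] is Some t then next t v else v.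

(* [None] stands for +oo. *)
Definition partner_rank (mu : {set 3.-tuple V}) (v : V) : option nat :=
  if matched mu v then Some (rank G v (partner mu v)) else None.

Definition lt_ext (r : nat) (R : option nat) : bool :=
  if R is Some k then r < k else true.

Definition blocking (mu : {set 3.-tuple V}) (v v' v'' : V) : bool :=
  [&& ucycleb (edge G) [:: v; v'; v''],
      lt_ext (rank G v v') (partner_rank mu v),
      lt_ext (rank G v' v'') (partner_rank mu v')
    & lt_ext (rank G v'' v) (partner_rank mu v'')].

Definition stable (mu : {set 3.-tuple V}) : Prop :=
  forall v v' v'', ~~ blocking mu v v' v''.

End Matchings.

(* [p u v = Some r] encodes an edge (u, v) of rank r, [p u v = None] the absence
   of an edge. *)
Definition ranked_graph_of (V : Type) (gen : V -> 'Z_3) (p : V -> V -> option nat) :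
    ranked_graph V :=
  RankedGraph gen (fun u v => isSome (p u v)) (fun u v => odflt 0 (p u v)).

(* [f] identifies [K] with a (not necessarily induced) subgraph of [G] having
   the same ranks. Genders are preserved up to a cyclic rotation, since those of
   the patterns below are only meaningful relative to one another. *)
Definition is_copy (W V : Type) (K : ranked_graph W) (G : ranked_graph V) (f : W -> V) :
    Prop :=
  [/\ injective f,
      forall u v, (gender G (f v) - gender G (f u)
                   = gender K v - gender K u)%R
    & forall u v, edge K u v ->
        edge G (f u) (f v) /\ rank G (f u) (f v) = rank K u v].

Definition verts (W V : finType) (f : W -> V) : {set V} := [set f w | w : W].

Definition rho (V : finType) (G : ranked_graph V) (v : V) : nat :=
  \max_(w | edge G v w) rank G v w.

Definition H_pref (u v : nat) : option nat :=
  match u, v with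
  | 0, 1 | 1, 2 | 2, 3 | 3, 4 | 4, 5 | 5, 0 | 6, 4 | 7, 8 | 8, 0 => Some 1
  | 4, 8 | 8, 6 | 0, 7 | 1, 5 | 5, 3 | 3, 1 => Some 2
  | 4, 2 => Some 3
  | _, _ => None
  end.

Definition graphH : ranked_graph 'I_9 :=
  ranked_graph_of (fun v : 'I_9 => inZp v) (fun u v : 'I_9 => H_pref u v).

Notation vH k := (@Ordinal 9 k isT).

Variant K1 := K1x | K1a | K1b | K1c | K1d | K1e | K1s | K1t.

Definition K1_code (u : K1) : 'I_8 :=
  match u with
  | K1x => @Ordinal 8 0 isT | K1a => @Ordinal 8 1 isT
  | K1b => @Ordinal 8 2 isT | K1c => @Ordinal 8 3 isT
  | K1d => @Ordinal 8 4 isT | K1e => @Ordinal 8 5 isT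
  | K1s => @Ordinal 8 6 isT | K1t => @Ordinal 8 7 isT
  end.

Definition K1_decode (i : 'I_8) : K1 :=
  nth K1x [:: K1x; K1a; K1b; K1c; K1d; K1e; K1s; K1t] i.

Lemma K1_codeK : cancel K1_code K1_decode. Proof. by case. Qed.

HB.instance Definition _ := Finite.copy K1 (can_type K1_codeK).

(* The gender of x is normalized to 0; likewise for the second gadget. *)
Definition K1_gender (u : K1) : 'Z_3 :=
  match u with
  | K1x | K1e | K1s => 0%R
  | K1c | K1d => 1%R
  | K1a | K1b | K1t => 2%R
  end.

Definition K1_pref (rx : nat) (u v : K1) : option nat :=
  match u, v with
  | K1e, K1c | K1c, K1a | K1d, K1a | K1a, K1x | K1b, K1x | K1t, K1e
  | K1s, K1d => Some 1
  | K1t, K1s | K1e, K1d | K1c, K1b | K1d, K1b | K1a, K1e | K1b, K1e => Some 2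
  | K1b, K1s | K1d, K1t => Some 3
  | K1x, K1c => Some rx
  | K1x, K1d => Some rx.+1
  | _, _ => None
  end.

Definition gadgetK1 (rx : nat) : ranked_graph K1 := ranked_graph_of K1_gender (K1_pref rx).

Variant K2 :=
  K2x | K2z | K2a | K2b | K2c | K2d | K2e | K2f | K2s | K2t.

Definition K2_code (u : K2) : 'I_10 :=
  match u with
  | K2x => @Ordinal 10 0 isT | K2z => @Ordinal 10 1 isT
  | K2a => @Ordinal 10 2 isT | K2b => @Ordinal 10 3 isT
  | K2c => @Ordinal 10 4 isT | K2d => @Ordinal 10 5 isT
  | K2e => @Ordinal 10 6 isT | K2f => @Ordinal 10 7 isT
  | K2s => @Ordinal 10 8 isT | K2t => @Ordinal 10 9 isT
  end.

Definition K2_decode (i : 'I_10) : K2 :=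
  nth K2x [:: K2x; K2z; K2a; K2b; K2c; K2d; K2e; K2f; K2s; K2t] i.

Lemma K2_codeK : cancel K2_code K2_decode. Proof. by case. Qed.

HB.instance Definition _ := Finite.copy K2 (can_type K2_codeK).

Definition K2_gender (u : K2) : 'Z_3 :=
  match u with
  | K2x | K2z | K2e | K2s => 0%R
  | K2c | K2d => 1%R
  | K2a | K2b | K2f | K2t => 2%R
  end.

Definition K2_pref (rx rz : nat) (u v : K2) : option nat :=
  match u, v with
  | K2e, K2c | K2c, K2a | K2d, K2a | K2a, K2x | K2b, K2x | K2t, K2e
  | K2s, K2d | K2f, K2e => Some 1
  | K2t, K2s | K2e, K2d | K2c, K2b | K2d, K2b | K2a, K2z | K2b, K2z => Some 2
  | K2a, K2e | K2b, K2e | K2d, K2t | K2c, K2f => Some 3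
  | K2b, K2s => Some 4
  | K2x, K2c => Some rx
  | K2x, K2d => Some rx.+1
  | K2z, K2c => Some rz
  | K2z, K2d => Some rz.+1
  | _, _ => None
  end.

Definition gadgetK2 (rx rz : nat) : ranked_graph K2 :=
  ranked_graph_of K2_gender (K2_pref rx rz).

Definition K1_at (V : finType) (G : ranked_graph V) (h : 'I_9 -> V) (x : 'I_9)
    (k : K1 -> V) : Prop :=
  [/\ is_copy (gadgetK1 (rho graphH x).+1) G k,
      k K1x = h x
    & verts k :&: verts h = [set h x]].

Definition K2_at (V : finType) (G : ranked_graph V) (h : 'I_9 -> V) (x z : 'I_9)
    (k : K2 -> V) : Prop :=
  [/\ is_copy (gadgetK2 (rho graphH x).+1 (rho graphH z).+1) G k,
      k K2x = h x,
      k K2z = h z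
    & verts k :&: verts h = [set h x; h z]].

(* Main.v *)
Require Import Defs.
From HB Require Import structures.
From mathcomp Require Import all_boot all_order all_algebra.

(** Fix a stable matching mu and say that a vertex v of H is served if mu sends
it to one of its out-neighbours in H, and pulled if some vertex of H is sent to v.
The gadget attached to v occupies the two ranks that follow those of H, so that v
prefers being served to what the gadget offers, and that to anything else. Three facts about the
gadgets are all that is used about the rest of G:
- in a copy of K_1, if x is pulled then x is served ([K1_trace]);
- in a copy of K_2, if x is pulled then x is served, unless z is served and not
  pulled ([K2_trace_x]);
- in a copy of K_2, if z is pulled then z is served, unless x is not pulled
  ([K2_trace_z]).
In each case the gadget has so few cycles that, were the conclusion false, some
3-cycle in it would block mu.

The first fact propagates along families: if a vertex of H is sent to a vertex of H
with a K_1, that one is served, so the whole family lies in H. As 6 can only be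
served by 4, which has a K_1, this excludes the exception in the second fact for the
vertices 3 and 6. Then 3 must be pulled, since otherwise 1, 2 and 3 would all be worse
off than in (1,2,3), which would block. So 3 lies in a family inside H, and by the
third fact 6 behaves as if it had a K_1. As 8 can only be served by 0 or 6, the
exception in the second fact is now excluded for 5 and 8 as well.

What remains is a case distinction on the family of 3, which is (3,1,2), (3,1,5),
(3,4,2), (3,4,5) or (3,4,8): each time some other 3-cycle of H blocks
([H_no_trace]). The vertex 8 alone could be pulled without being served, and only if
5 is not pulled; (3,4,8) is the case where this has to be taken into account.

All of this concerns only what mu does inside a fixed subgraph (H or a gadget) whose
edges out of a vertex fill an initial segment of the ranks, or a segment starting
right after those of H. The trace of mu on such a subgraph ([stable_trace]) records
which of its vertices follow which in mu and the fact that none of its 3-cycles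
blocks ([copy_trace]). *)

Set Implicit Arguments.
Unset Strict Implicit.
Unset Printing Implicit Defensive.
Set Bullet Behavior "Strict Subproofs".

(** * Successors in a matching *)

Section Successors.
Variables (V : finType) (G : ranked_graph V) (mu : {set 3.-tuple V}).

(** Unlike [partner], this never relates an unmatched vertex to itself. *)
Definition follows (u v : V) : bool := matched mu u && (partner mu u == v).

(** This is R_mu(u) <= r, where an unmatched vertex has infinite rank. *)
Definition rank_within (u : V) (r : nat) : bool :=
  matched mu u && (rank G u (partner mu u) <= r).

Hypothesis mu_matching : is_matching G mu.

Lemma follows_family u v :
  follows u v -> exists t, [/\ t \in mu, u \in t & next t u = v].
Proof.
case/andP=> /existsP[t0 t0P] /eqP; rewrite /partner.
case: pickP => [t /andP[tmu ut] <-|/(_ t0)]; first by exists t.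
by rewrite t0P.
Qed.

Lemma family_follows t u : t \in mu -> u \in t -> follows u (next t u).
Proof.
move=> tmu ut; apply/andP; split; first by apply/existsP; exists t; rewrite tmu.
rewrite /partner; case: pickP => [t' /andP[t'mu ut']|/(_ t)]; last by rewrite tmu ut.
have [-> //|tt'] := eqVneq t t'.
have /disjointFr/(_ ut) := mu_matching.2 t t' tmu t'mu tt'.
by rewrite ut'.
Qed.

Lemma family_unique t t' u : t \in mu -> t' \in mu -> u \in t -> u \in t' -> t = t'.
Proof.
move=> tmu t'mu ut ut'; apply/eqP; apply: contraTT ut' => tt'.
by rewrite (disjointFr (mu_matching.2 t t' tmu t'mu tt') ut).
Qed.

Lemma family_uniq t : t \in mu -> uniq t.
Proof. by move=> /mu_matching.1/andP[/andP[]]. Qed.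

Lemma next3 (t : seq V) u :
  size t = 3 -> uniq t -> u \in t -> next t (next t (next t u)) = u.
Proof.
case: t => [|x [|y [|z [|]]]] //= _; rewrite !inE negb_or andbT.
case/andP=> /andP[/negbTE xy /negbTE xz] /negbTE yz.
by case/or3P=> /eqP->; rewrite !(eqxx, xy, xz, yz, eq_sym y x, eq_sym z x, eq_sym z y).
Qed.

Lemma follows_fun u v w : follows u v -> follows u w -> v = w.
Proof. by case/andP=> _ /eqP<- /andP[_ /eqP]. Qed.

Lemma follows_inj u v w : follows u w -> follows v w -> u = v.
Proof.
case/follows_family=> t [tmu ut nu] /follows_family[t' [t'mu vt' nv]].
have wt : w \in t by rewrite -nu mem_next.
have wt' : w \in t' by rewrite -nv mem_next.
have tt' := family_unique tmu t'mu wt wt'.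
by rewrite -(prev_next (family_uniq tmu) u) nu tt' -nv prev_next // family_uniq.
Qed.

Lemma follows_cycle u v w : follows u v -> follows v w -> follows w u.
Proof.
case/follows_family=> t [tmu ut nu] /follows_family[t' [t'mu vt' nv]].
have vt : v \in t by rewrite -nu mem_next.
have tt' := family_unique tmu t'mu vt vt'.
have <- : next t (next t (next t u)) = u by rewrite next3 ?size_tuple ?family_uniq.
by rewrite nu tt' nv family_follows // -nv mem_next.
Qed.

(** The form in which stability is used everywhere: one of the three vertices of
a cycle is already at least as well off. *)
Lemma stable_cycle u v w : stable G mu -> ucycleb (edge G) [:: u; v; w] ->
  [\/ rank_within u (rank G u v), rank_within v (rank G v w)
    | rank_within w (rank G w u)].
Proof.
move=> st uvw; have := st u v w; rewrite /blocking uvw /=.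
have not_lt a r : ~~ lt_ext r (partner_rank G mu a) -> rank_within a r.
  by rewrite /partner_rank /rank_within; case: matched => //=; rewrite -leqNgt.
by case/nandP=> [|/nandP[]] /not_lt; [exact: Or31|exact: Or32|exact: Or33].
Qed.

End Successors.

(** * The trace of a stable matching on a subgraph *)

Section Traces.
Variables (W : finType) (K : ranked_graph W) (top : pred W) (R : rel W).

(** [R] is meant to be the successor relation of a matching of a larger graph,
restricted to [K], and [top u] to say that [u] is sent to some vertex, perhaps
outside [K], that it prefers to all its out-neighbours in [K]. *)
Definition sated (u v : W) : Prop :=
  top u \/ exists y, [/\ edge K u y, rank K u y <= rank K u v & R u y].

Record stable_trace : Prop := StableTrace {
  trace_fun : forall u v w, R u v -> R u w -> v = w;
  trace_inj : forall u v w, R u w -> R v w -> u = v;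
  trace_cycle : forall u v w, R u v -> R v w -> R w u;
  trace_stable : forall u v w, ucycleb (edge K) [:: u; v; w] ->
    [\/ sated u v, sated v w | sated w u] }.

End Traces.

(** Thanks to this condition, where the ranks of [K] out of [u] are consecutive
from [(base u).+1] on, a vertex that is sent to something no worse than an
out-neighbour in [K], but not among its [base u] favourites, is sent to an
out-neighbour in [K]. *)
Definition fills_ranks (W : finType) (K : ranked_graph W) (base : W -> nat) :=
  forall u v r, edge K u v -> base u < r <= rank K u v ->
    exists2 y, edge K u y & rank K u y = r.

Section CopyTrace.
Variables (n : nat) (V : finType) (G : ranked_graph V) (mu : {set 3.-tuple V}).
Hypotheses (hG : is_3DSMI n G) (mu_matching : is_matching G mu).

Lemma rank_gt0 u v : edge G u v -> 0 < rank G u v.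
Proof.
case: hG => _ _ /(_ u)/perm_mem/(_ (rank G u v)) + uv.
by rewrite mem_iota map_f ?mem_enum ?inE // => /esym/andP[].
Qed.

Lemma rank_inj u v w :
  edge G u v -> edge G u w -> rank G u v = rank G u w -> v = w.
Proof.
case: hG => _ _ /(_ u)/perm_uniq; rewrite iota_uniq => /dinjectiveP inj uv uw.
by apply: inj; rewrite inE.
Qed.

Lemma follows_edge u v : follows mu u v -> edge G u v.
Proof.
case/follows_family=> t [tmu ut <-].
by apply: next_cycle ut; have /mu_matching.1/andP[/andP[]] := tmu.
Qed.

Variables (W : finType) (K : ranked_graph W) (f : W -> V) (base : W -> nat).
Hypotheses (Kf : is_copy K G f) (K_fills : fills_ranks K base).

Lemma rank_within_copy u v r :
    edge K u v -> r <= rank K u v -> rank_within G mu (f u) r ->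
  rank_within G mu (f u) (base u) \/
  exists y, [/\ edge K u y, rank K u y <= r & follows mu (f u) (f y)].
Proof.
case: Kf => _ _ copyE uv r_le /andP[fu_in le_r].
have fu : follows mu (f u) (partner mu (f u)) by rewrite /follows fu_in eqxx.
have [le_b|lt_b] := leqP (rank G (f u) (partner mu (f u))) (base u).
  by left; rewrite /rank_within fu_in.
right; have [|y uy ry] := K_fills (r := rank G (f u) (partner mu (f u))) uv.
  by rewrite lt_b (leq_trans le_r).
exists y; have [fuy rfuy] := copyE _ _ uy; rewrite uy ry le_r; split=> //.
by rewrite -(rank_inj (follows_edge fu) fuy _) ?rfuy.
Qed.

Lemma copy_trace : stable G mu ->
  stable_trace K (fun u => rank_within G mu (f u) (base u))
    (fun u v => follows mu (f u) (f v)).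
Proof.
case: (Kf) => f_inj _ copyE st; split.
- by move=> u v w uv uw; apply/f_inj/(follows_fun uv uw).
- by move=> u v w uw vw; apply/f_inj/(follows_inj mu_matching uw vw).
- by move=> u v w; apply: (follows_cycle mu_matching).
- move=> u v w /andP[/and4P[uv vw wu _] uvw_uniq].
  have [fuv ruv] := copyE _ _ uv; have [fvw rvw] := copyE _ _ vw.
  have [fwu rwu] := copyE _ _ wu.
  have : ucycleb (edge G) [:: f u; f v; f w].
    rewrite /ucycleb -[uniq _]/(uniq (map f [:: u; v; w])) map_inj_uniq // uvw_uniq.
    by rewrite /= fuv fvw fwu.
  case/(stable_cycle st); rewrite ?ruv ?rvw ?rwu => within.
  + exact/Or31/(rank_within_copy uv).
  + exact/Or32/(rank_within_copy vw).
  + exact/Or33/(rank_within_copy wu).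
Qed.

Lemma no_rank_within0 u : rank_within G mu u 0 = false.
Proof.
apply/negP=> /andP[u_in]; rewrite leqn0 => /eqP r0.
have /follows_edge/rank_gt0 : follows mu u (partner mu u) by rewrite /follows u_in eqxx.
by rewrite r0.
Qed.

Lemma rank_within_rho u : base u = 0 ->
  rank_within G mu (f u) (rho K u) -> exists2 y, edge K u y & follows mu (f u) (f y).
Proof.
move=> b0 within.
have [v uv rho_v] : exists2 v, edge K u v & rho K u <= rank K u v.
  case: (pickP (edge K u)) => [v0 uv0|none].
    have [v uv max_v] := eq_bigmax_cond (rank K u) (introT card_gt0P (ex_intro _ v0 uv0)).
    by exists v => //; rewrite -max_v /rho leqnn.
  by move: within; rewrite /rho big_pred0 // no_rank_within0.
case: (rank_within_copy uv rho_v within) => [|[y [uy _ fuy]]].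
  by rewrite b0 no_rank_within0.
by exists y.
Qed.
End CopyTrace.

(** * Reasoning on traces by cases *)

(** Closes [R] under the cyclic symmetry of families. *)
Ltac follow_cycles T R :=
  repeat match goal with
  | Huv : is_true (R ?u ?v), Hvw : is_true (R ?v ?w) |- _ =>
    lazymatch goal with
    | _ : is_true (R w u) |- _ => fail
    | _ => have ? := trace_cycle T Huv Hvw
    end
  end.

(** Contradictions between the known values of [R]: two successors or two
predecessors of a vertex, or a pair excluded by hypothesis. *)
Ltac refute T R :=
  follow_cycles T R;
  match goal with
  | H : is_true (R ?u ?v), H' : is_true (R ?u ?w) |- _ =>
    by have := trace_fun T H H'
  | H : is_true (R ?u ?w), H' : is_true (R ?v ?w) |- _ =>
    by have := trace_inj T H H'
  | H : is_true (R ?u ?v), H' : ~ is_true (R ?u ?v) |- _ => by case: (H' H)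
  end.

Lemma ord9_ind (P : 'I_9 -> Prop) :
  P (vH 0) -> P (vH 1) -> P (vH 2) -> P (vH 3) -> P (vH 4) -> P (vH 5) ->
  P (vH 6) -> P (vH 7) -> P (vH 8) -> forall v, P v.
Proof.
move=> P0 P1 P2 P3 P4 P5 P6 P7 P8 [m m9].
do 9?[case: m m9 => [|m] m9; first by rewrite (bool_irrelevance m9 isT)].
by [].
Qed.

(** The vertices of H are ordinals, those of the gadgets are constructors. *)
Ltac vertex_cases := first [apply: ord9_ind | case].

Ltac sated_cases T R no_top :=
  let E := fresh "E" in let L := fresh "L" in let N := fresh "N" in
  let y := fresh "y" in
  intros [N|[y [E L N]]];
  [ by case: (no_top _ N)
  | revert y E L N; vertex_cases; intros E L N;
    try discriminate E; try discriminate L;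
    try (by move: L; rewrite /= ltnn); clear E L; try (by refute T R) ].

(** Uses that the cycle [(u, v, w)] does not block: one case for each successor,
in the pattern, that would make one of its vertices sated. Impossible cases are
discharged; [no_top] refutes [top]. *)
Ltac unblock T R no_top u v w :=
  case: (trace_stable T (u := u) (v := v) (w := w) isT); sated_cases T R no_top.

(** * The ranks of the patterns are consecutive *)

Ltac low_rank_witness q q_gt0 q_le :=
  destruct q as [|[|[|[|[|q]]]]]; try discriminate q_gt0; try discriminate q_le;
  first
    [ by exists K1a | by exists K1b | by exists K1c | by exists K1d | by exists K1e
    | by exists K1s | by exists K1t | by exists K1x
    | by exists K2a | by exists K2b | by exists K2c | by exists K2d | by exists K2e
    | by exists K2f | by exists K2s | by exists K2t | by exists K2x | by exists K2z
    | by exists (vH 0) | by exists (vH 1) | by exists (vH 2) | by exists (vH 3)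
    | by exists (vH 4) | by exists (vH 5) | by exists (vH 6) | by exists (vH 7)
    | by exists (vH 8) ].

Lemma two_next_ranks r q m : r < q <= m -> m <= r.+2 -> q = r.+1 \/ q = r.+2.
Proof.
case/andP=> rq qm mr; have := leq_trans qm mr.
by rewrite leq_eqVlt ltnS => /predU1P[|qr]; [right|left; apply/eqP; rewrite eqn_leq qr].
Qed.

Lemma K1_fills r : fills_ranks (gadgetK1 r.+1) (fun u => if u is K1x then r else 0).
Proof.
move=> u v q uv rq; have [ux|ux] := eqVneq u K1x.
  move: uv rq; rewrite ux => uv rq.
  have le2 : rank (gadgetK1 r.+1) K1x v <= r.+2.
    by case: v uv rq => //= _ _; rewrite leqnSn.
  by have [->|->] := two_next_ranks rq le2; [exists K1c | exists K1d].
case/andP: rq; case: u uv ux => //; case: v => // uv _ q_gt0 q_le;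
  low_rank_witness q q_gt0 q_le.
Qed.

Lemma K2_fills rx rz : fills_ranks (gadgetK2 rx.+1 rz.+1)
  (fun u => match u with K2x => rx | K2z => rz | _ => 0 end).
Proof.
move=> u v q uv rq; have [ux|ux] := eqVneq u K2x.
  move: uv rq; rewrite ux => uv rq.
  have le2 : rank (gadgetK2 rx.+1 rz.+1) K2x v <= rx.+2.
    by case: v uv rq => //= _ _; rewrite leqnSn.
  by have [->|->] := two_next_ranks rq le2; [exists K2c | exists K2d].
have [uz|uz] := eqVneq u K2z.
  move: uv rq; rewrite uz => uv rq.
  have le2 : rank (gadgetK2 rx.+1 rz.+1) K2z v <= rz.+2.
    by case: v uv rq => //= _ _; rewrite leqnSn.
  by have [->|->] := two_next_ranks rq le2; [exists K2c | exists K2d].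
case/andP: rq; case: u uv ux uz => //; case: v => // uv _ _ q_gt0 q_le;
  low_rank_witness q q_gt0 q_le.
Qed.

Lemma H_fills : fills_ranks graphH (fun=> 0).
Proof.
elim/ord9_ind; elim/ord9_ind => // q uv /andP[q_gt0 q_le]; low_rank_witness q q_gt0 q_le.
Qed.

(** * The gadgets *)

(** Suppose that neither [top K1x] holds nor a, b or t is sent to x. As (x,c,a) does
not block, either x goes to c, and then e would have to follow both a and b because
of (e,c,a) and (e,c,b), or c goes to a. In this case (x,d,a) forces x to go to d, and
(e,d,b) leaves two possibilities: if e goes to c, then (s,d,b) and (s,d,t) send both
b and t to s, and if b goes to e, then (e,d,a) blocks. *)
Lemma K1_trace r top R : stable_trace (gadgetK1 r.+1) top R ->
  (forall u, top u -> u = K1x) ->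
  [\/ top K1x, R K1a K1x, R K1b K1x | R K1t K1x].
Proof.
move=> T topx.
have [?|ntop] := boolP (top K1x); first exact: Or41.
have [?|/negP nax] := boolP (R K1a K1x); first exact: Or42.
have [?|/negP nbx] := boolP (R K1b K1x); first exact: Or43.
have [?|/negP ntx] := boolP (R K1t K1x); first exact: Or44.
have no_top u : ~ top u by move=> tu; move: (tu); rewrite (topx u tu) => /(negP ntop).
exfalso.
unblock T R no_top K1x K1c K1a.
- unblock T R no_top K1e K1c K1a.
  unblock T R no_top K1e K1c K1b.
- unblock T R no_top K1x K1d K1a.
  unblock T R no_top K1e K1d K1b.
  + unblock T R no_top K1s K1d K1b.
    unblock T R no_top K1s K1d K1t.
  + unblock T R no_top K1e K1d K1a.
Qed.

Section SharedGadget.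
Variables (rx rz : nat) (top : pred K2) (R : rel K2).
Hypothesis T : stable_trace (gadgetK2 rx.+1 rz.+1) top R.
Hypothesis topxz : forall u, top u -> u = K2x \/ u = K2z.

(** Compared with K_1, the vertices a and b can also be content with z. If x goes to c,
then (e,c,f) sends f to e, and (e,c,a) and (e,c,b) can only be unblocked by sending
both a and b to z. If x goes to d, then c goes to a, and by (e,d,t) either t goes to
e, in which case a and b again both need z, or e goes to c, in which case t goes to s
and only z is left for b.

The exception is genuine: (e,c,a) in mu, x sent to d, t to s and b to z leave no
blocking cycle in the gadget, provided that z is better off than with d; otherwise
(z,d,a) blocks. *)
Lemma K2_trace_x :
  [\/ top K2x, [\/ R K2a K2x, R K2b K2x, R K2f K2x | R K2t K2x]
    | top K2z /\ R K2b K2z].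
Proof.
have [?|ntop] := boolP (top K2x); first exact: Or31.
have [?|/negP nax] := boolP (R K2a K2x); first exact/Or32/Or41.
have [?|/negP nbx] := boolP (R K2b K2x); first exact/Or32/Or42.
have [?|/negP nfx] := boolP (R K2f K2x); first exact/Or32/Or43.
have [?|/negP ntx] := boolP (R K2t K2x); first exact/Or32/Or44.
apply: Or33.
have only_z u : top u -> u = K2z.
  by move=> tu; case: (topxz tu) => // ux; case/negP: ntop; rewrite -ux.
have no_top u : top u -> ~ u != K2z by move/only_z=> ->.
unblock T R no_top K2x K2c K2a.
- unblock T R no_top K2e K2c K2f.
  unblock T R no_top K2e K2c K2a.
  unblock T R no_top K2e K2c K2b.
- unblock T R no_top K2x K2d K2a.
  unblock T R no_top K2e K2d K2t.
  + unblock T R no_top K2s K2d K2t.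
    unblock T R no_top K2s K2d K2b.
    split=> //.
    case: (boolP (top K2z)) => // /negP ntz.
    have {}no_top u : ~ top u by move=> tu; move: (tu); rewrite (only_z u tu).
    unblock T R no_top K2z K2d K2a.
  + unblock T R no_top K2e K2d K2b.
    unblock T R no_top K2e K2d K2a.
Qed.

(** If a and b are not sent to x either, z cannot go to c: (e,c,f) would send f to e,
and nothing would be left for a in (e,c,a). So c goes to a, z goes to d by (z,d,a),
and by (e,d,t) either t goes to e, so that (e,d,b) blocks, or e goes to c, and then
(s,d,t) and (s,d,b) would send both t and b to s.

The exception is genuine here too: with (x,d,a) and (e,c,b) in mu, no cycle of the
gadget blocks, wherever z is sent. *)
Lemma K2_trace_z :
  [\/ top K2z, [\/ R K2a K2z, R K2b K2z, R K2f K2z | R K2t K2z]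
    | R K2a K2x \/ R K2b K2x].
Proof.
have [?|ntop] := boolP (top K2z); first exact: Or31.
have [?|/negP naz] := boolP (R K2a K2z); first exact/Or32/Or41.
have [?|/negP nbz] := boolP (R K2b K2z); first exact/Or32/Or42.
have [?|/negP nfz] := boolP (R K2f K2z); first exact/Or32/Or43.
have [?|/negP ntz] := boolP (R K2t K2z); first exact/Or32/Or44.
have [?|/negP nax] := boolP (R K2a K2x); first exact/Or33/or_introl.
have [?|/negP nbx] := boolP (R K2b K2x); first exact/Or33/or_intror.
have only_x u : top u -> u = K2x.
  by move=> tu; case: (topxz tu) => // uz; case/negP: ntop; rewrite -uz.
have no_top u : top u -> ~ u != K2x by move/only_x=> ->.
exfalso.
unblock T R no_top K2z K2c K2a.
- unblock T R no_top K2e K2c K2f.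
  unblock T R no_top K2e K2c K2a.
- unblock T R no_top K2z K2d K2a.
  unblock T R no_top K2e K2d K2t.
  + unblock T R no_top K2s K2d K2t.
    unblock T R no_top K2s K2d K2b.
  + unblock T R no_top K2e K2d K2b.
Qed.
End SharedGadget.

(** * The graph H *)

Section TraceOnH.
Variable R : rel 'I_9.

Definition served v := [exists y, edge graphH v y && R v y].
Definition pulled v := [exists u, R u v].

Hypothesis T : stable_trace graphH pred0 R.
Hypothesis pulled_served :
  forall v, v \in [:: vH 0; vH 1; vH 2; vH 4; vH 7] -> pulled v -> served v.
Hypothesis pulled_x :
  forall x z, (x, z) \in [:: (vH 3, vH 6); (vH 5, vH 8)] ->
    pulled x -> served x \/ served z /\ ~~ pulled z.
Hypothesis pulled_z :
  forall x z, (x, z) \in [:: (vH 3, vH 6); (vH 5, vH 8)] ->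
    pulled z -> served z \/ ~~ pulled x.

Lemma pulled_of u v : R u v -> pulled v.
Proof. by move=> uv; apply/existsP; exists u. Qed.

(** If [v] is served, by [w] say, then [(u, v, w)] is a family, in which [w] is sent to [u]. *)
Lemma served_cycle u v : R u v -> (pulled v -> served v) -> pulled u.
Proof.
move=> uv /(_ (pulled_of uv))/existsP[w /andP[_ vw]].
exact: pulled_of (trace_cycle T uv vw).
Qed.

Ltac served_cases H :=
  let E := fresh "E" in let N := fresh "N" in
  case/existsP: H; vertex_cases; case/andP=> E N; try discriminate E; clear E;
  try (by refute T R).

Let no_pred0 (v : 'I_9) : ~ pred0 v.
Proof. by []. Qed.

Ltac unblock_H u v w := unblock T R no_pred0 u v w.

Lemma H_no_trace : False.
Proof.
have s0 := @pulled_served (vH 0) isT.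
have s1 := @pulled_served (vH 1) isT.
have s2 := @pulled_served (vH 2) isT.
have s4 := @pulled_served (vH 4) isT.
have s7 := @pulled_served (vH 7) isT.
have p6 : served (vH 6) -> pulled (vH 6).
  by move=> H; served_cases H; apply: served_cycle N s4.
have s3 : pulled (vH 3) -> served (vH 3).
  by move=> /(@pulled_x (vH 3) (vH 6) isT)[//|[/p6 ->]].
have p3 : pulled (vH 3).
{ case: (boolP (pulled (vH 3))) => // np3.
  unblock_H (vH 1) (vH 2) (vH 3).
  - have H := s2 (pulled_of N); served_cases H.
    by rewrite (pulled_of N0) in np3.
  - by rewrite (pulled_of N) in np3.
  - by rewrite (served_cycle N s1) in np3.
  - by rewrite (served_cycle N s4) in np3. }
have s6 : pulled (vH 6) -> served (vH 6).
  by move=> /(@pulled_z (vH 3) (vH 6) isT)[//|]; rewrite p3.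
have p8 : served (vH 8) -> pulled (vH 8).
  by move=> H; served_cases H; [apply: served_cycle N s0 | apply: served_cycle N s6].
have s5 : pulled (vH 5) -> served (vH 5).
  by move=> /(@pulled_x (vH 5) (vH 8) isT)[//|[/p8 ->]].
have s8 : pulled (vH 5) -> pulled (vH 8) -> served (vH 8).
  by move=> p5 /(@pulled_z (vH 5) (vH 8) isT)[//|]; rewrite p5.
have H3 := s3 p3; served_cases H3.
(* The family of 3 is (3,1,2), (3,1,5), (3,4,2), (3,4,5) or (3,4,8), in this order. *)
- have H1 := s1 (pulled_of N); served_cases H1.
  + have ns5 : ~ served (vH 5).
    { move=> H5; served_cases H5.
      have H0 := s0 (pulled_of N1); served_cases H0.
      have H7 := s7 (pulled_of N2); served_cases H7. }
    unblock_H (vH 3) (vH 4) (vH 5).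
    * by case: ns5; exact: s5 (pulled_of N1).
    * by case: ns5; apply/existsP; exists (vH 0).
  + unblock_H (vH 3) (vH 4) (vH 2).
    * have H2 := s2 (pulled_of N1); served_cases H2.
    * have H8 := s8 (pulled_of N0) (pulled_of N1); served_cases H8.
      -- have H0 := s0 (pulled_of N2); served_cases H0.
      -- unblock_H (vH 0) (vH 7) (vH 8).
         have H7 := s7 (pulled_of N3); served_cases H7.
- have H4 := s4 (pulled_of N); served_cases H4.
  + unblock_H (vH 4) (vH 8) (vH 6).
    * have H0 := s0 (pulled_of N1); served_cases H0.
      -- have H1 := s1 (pulled_of N2); served_cases H1.
      -- unblock_H (vH 0) (vH 1) (vH 5).
         have H5 := s5 (pulled_of N3); served_cases H5.
    * have H6 := s6 (pulled_of N1); served_cases H6.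
  + have ns1 : ~ served (vH 1).
    { move=> H1; served_cases H1.
      have H2 := s2 (pulled_of N1); served_cases H2. }
    unblock_H (vH 0) (vH 1) (vH 5).
    * by case: ns1; exact: s1 (pulled_of N1).
    * by case: ns1; apply/existsP; exists (vH 2).
  (* Here 8 goes to 3, so it is not served although it is pulled; hence 5 is not
     pulled, and (0,1,5) blocks. *)
  + have np5 : ~ pulled (vH 5).
    { by move=> p5; have H8 := s8 p5 (pulled_of N0); served_cases H8. }
    have ns1 : ~ served (vH 1).
    { move=> H1; served_cases H1; first by have H2 := s2 (pulled_of N1); served_cases H2.
      exact: np5 (pulled_of N1). }
    unblock_H (vH 0) (vH 1) (vH 5).
    * by case: ns1; exact: s1 (pulled_of N1).
    * by case: ns1; apply/existsP; exists (vH 2).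
    * exact: np5 (pulled_of N1).
    * exact: np5 (served_cycle N1 s0).
Qed.
End TraceOnH.

(** * Gluing the gadgets to H *)

Section Gluing.
Variables (n : nat) (V : finType) (G : ranked_graph V) (h : 'I_9 -> V).
Variable mu : {set 3.-tuple V}.
Hypotheses (hG : is_3DSMI n G) (hH : is_copy graphH G h).
Hypotheses (mu_matching : is_matching G mu) (mu_stable : stable G mu).

Let R (u v : 'I_9) : bool := follows mu (h u) (h v).

Lemma H_trace : stable_trace graphH pred0 R.
Proof.
have T := copy_trace hG mu_matching hH H_fills mu_stable.
split; [exact: trace_fun T|exact: trace_inj T|exact: trace_cycle T|].
move=> u v w /(trace_stable T); rewrite /sated /=.
by rewrite !(no_rank_within0 hG mu_matching).
Qed.

Lemma served_within v : rank_within G mu (h v) (rho graphH v) -> served R v.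
Proof.
case/(rank_within_rho hG mu_matching hH H_fills (erefl : (fun=> 0) v = 0)) => y vy fy.
by apply/existsP; exists y; rewrite vy.
Qed.

(** Predecessors are unique, so a vertex of the gadget other than x and z that is
followed by a vertex of H excludes a predecessor in H. *)
Lemma outside_pull w v : follows mu w (h v) -> w \notin verts h -> ~~ pulled R v.
Proof.
move=> wv w_out; apply/existsP=> -[u uv]; case/negP: w_out.
by rewrite (follows_inj mu_matching wv uv) imset_f.
Qed.

Lemma K1_pulled_served x k : K1_at G h x k -> pulled R x -> served R x.
Proof.
case=> kK kx kh; have T := copy_trace hG mu_matching kK (@K1_fills _) mu_stable.
have outside u : u != K1x -> k u \notin verts h.
  move=> ux; apply: contra ux => ku; case: kK => k_inj _ _.
  have : k u \in verts k :&: verts h by rewrite inE ku imset_f.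
  by rewrite kh -kx inE => /eqP/k_inj->.
have topx u : rank_within G mu (k u) (if u is K1x then rho graphH x else 0) -> u = K1x.
  by case: u => //=; rewrite (no_rank_within0 hG mu_matching).
case: (K1_trace T topx); rewrite kx; first by move/served_within.
all: by move/outside_pull; rewrite outside // => /(_ isT)/negbTE->.
Qed.

Section Shared.
Variables (x z : 'I_9) (k : K2 -> V).
Hypothesis kxz : K2_at G h x z k.

Let T : stable_trace (gadgetK2 (rho graphH x).+1 (rho graphH z).+1) _ _ :=
  let: And4 kK _ _ _ := kxz in
  copy_trace hG mu_matching kK (@K2_fills _ _) mu_stable.

Let topxz u : rank_within G mu (k u)
    (match u with K2x => rho graphH x | K2z => rho graphH z | _ => 0 end) ->
  u = K2x \/ u = K2z.
Proof. by case: u; rewrite ?(no_rank_within0 hG mu_matching) //; [left|right]. Qed.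

Let outside u : u != K2x -> u != K2z -> k u \notin verts h.
Proof.
move=> ux uz; apply/negP=> ku; case: kxz => -[k_inj _ _] kx kz kh.
have : k u \in verts k :&: verts h by rewrite inE ku imset_f.
by rewrite kh -kx -kz !inE => /orP[]/eqP/k_inj uE; [case/eqP: ux|case/eqP: uz].
Qed.

Lemma K2_pulled_x : pulled R x -> served R x \/ served R z /\ ~~ pulled R z.
Proof.
move=> px; case: (kxz) => _ kx kz _.
case: (K2_trace_x T topxz); rewrite ?kx ?kz.
- by left; apply: served_within.
- by case=> /outside_pull; rewrite outside // => /(_ isT); rewrite px.
- by case=> /served_within ? /outside_pull; rewrite outside // => /(_ isT); right.
Qed.

Lemma K2_pulled_z : pulled R z -> served R z \/ ~~ pulled R x.
Proof.
move=> pz; case: (kxz) => _ kx kz _.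
case: (K2_trace_z T topxz); rewrite ?kx ?kz.
- by left; apply: served_within.
- by case=> /outside_pull; rewrite outside // => /(_ isT); rewrite pz.
- by case=> /outside_pull; rewrite outside // => /(_ isT); right.
Qed.

End Shared.
End Gluing.

Theorem theorem2 (n : nat) (V : finType) (G : ranked_graph V) (h : 'I_9 -> V)
    (k0 k1 k2 k4 k7 : K1 -> V) (k36 k58 : K2 -> V)
    (hG : is_3DSM n G)
    (hH : is_copy graphH G h)
    (h0 : K1_at G h (vH 0) k0)
    (h1 : K1_at G h (vH 1) k1)
    (h2 : K1_at G h (vH 2) k2)
    (h4 : K1_at G h (vH 4) k4)
    (h7 : K1_at G h (vH 7) k7)
    (h36 : K2_at G h (vH 3) (vH 6) k36)
    (h58 : K2_at G h (vH 5) (vH 8) k58)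
    (hdisj : pairwise (fun A B : {set V} => [disjoint A & B])
       [:: verts k36; verts k58; verts k0; verts k1; verts k2; verts k4;
           verts k7])
    (hcover : verts k36 :|: verts k58 :|:
       (verts k0 :|: verts k1 :|: verts k2 :|: verts k4 :|: verts k7)
       = [set: V]) :
  ~ exists mu : {set 3.-tuple V}, is_matching G mu /\ stable G mu.
Proof.
case=> mu [mu_matching mu_stable]; case: hG => hG' _.
apply: (H_no_trace (H_trace hG' hH mu_matching mu_stable)).
- move=> v; rewrite !inE => v_in.
  case/or4P: v_in => [||| /orP[]] /eqP->; apply: K1_pulled_served; eassumption.
- by move=> x z; rewrite !inE => /orP[] /eqP[-> ->]; apply: K2_pulled_x; eassumption.
- by move=> x z; rewrite !inE => /orP[] /eqP[-> ->]; apply: K2_pulled_z; eassumption.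
Qed.
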